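(* For every integer $n\geq 1$, $$f_{\leq 3}^n=\frac{3^{n-1}+1}{2}.$$
   Context: All posets are finite. A semiorder is a poset with no induced subposet isomorphic to $\mathbf{2}+\mathbf{2}$ (disjoint union of two 2-element chains with no other comparabilities) or $\mathbf{3}+\mathbf{1}$ (disjoint union of a 3-element chain and a single incomparable element). Its length is the length of a longest chain (a chain with $\ell+1$ elements has length $\ell$). $f_{\leq 3}^n$ denotes the number of nonisomorphic unlabeled semiorders with $n$ elements and length at most $3$. *)

(* Defs.v *)
From mathcomp Require Import all_boot all_fingroup.

Set Implicit Arguments.
Unset Strict Implicit.
Unset Printing Implicit Defensive.

(* A poset structure on T is its non-strict order relation, stored as a finite
   function so that the poset structures on T form a finite type. *)
Definition rel_of (T : finType) (r : {ffun T -> {ffun T -> bool}}) : rel T := fun x y => r x y.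

Section Posets.
Variable T : finType.
Implicit Types (r s : rel T) (A : {set T}).

Definition is_poset r : bool :=
  [&& [forall x, r x x],
      [forall x, forall y, (r x y && r y x) ==> (x == y)] &
      [forall y, forall x, forall z, r x y ==> r y z ==> r x z]].

Lemma is_posetP r :
  reflect [/\ reflexive r, antisymmetric r & transitive r] (is_poset r).
Proof.
apply: (iffP and3P) => [] [Hr Ha Ht]; split.
- by move=> x; apply: (forallP Hr).
- by move=> x y Hxy; apply/eqP; apply: (implyP (forallP (forallP Ha x) y)).
- move=> y x z Hxy Hyz.
  by have /forallP/(_ x)/forallP/(_ z) := forallP Ht y; rewrite Hxy Hyz.
- by apply/forallP.
- by apply/forallP => x; apply/forallP => y; apply/implyP => /Ha ->.
- apply/forallP => y; apply/forallP => x; apply/forallP => z.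
  by apply/implyP => Hxy; apply/implyP; apply: Ht.
Qed.

Definition is_chain r A : bool :=
  [forall x in A, forall y in A, r x y || r y x].

(* A chain with l + 1 elements has length l. *)
Definition poset_length r : nat := \max_(A : {set T} | is_chain r A) #|A|.-1.

Definition poset_iso r s : bool :=
  [exists p : {perm T}, forall x, forall y, r x y == s (p x) (p y)].

Lemma poset_isoP r s :
  reflect (exists p : {perm T}, forall x y, r x y = s (p x) (p y))
          (poset_iso r s).
Proof.
apply: (iffP existsP) => [] [p Hp]; exists p.
  by move=> x y; apply/eqP; apply: (forallP (forallP Hp x)).
by apply/forallP => x; apply/forallP => y; apply/eqP.
Qed.

Lemma poset_iso_equiv : equivalence_rel poset_iso.
Proof.
have sub r s t : poset_iso r s -> poset_iso s t -> poset_iso r t.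
  move=> /poset_isoP[p Hp] /poset_isoP[q Hq]; apply/poset_isoP.
  by exists (p * q)%g => x y; rewrite Hp Hq !permM.
have sym r s : poset_iso r s -> poset_iso s r.
  move=> /poset_isoP[p Hp]; apply/poset_isoP.
  by exists (p^-1)%g => x y; rewrite Hp !permKV.
move=> r s t; split; first by apply/poset_isoP; exists 1%g => x y; rewrite !perm1.
by move=> Hrs; apply/idP/idP; apply: sub => //; apply: sym.
Qed.

End Posets.

(* Some induced subposet of (T, r) is isomorphic to (S, p). *)
Definition contains_induced (S T : finType) (p : rel S) (r : rel T) : bool :=
  [exists f : {ffun S -> T},
    injectiveb f && [forall a, forall b, r (f a) (f b) == p a b]].

Definition chain_rel (k : nat) : rel 'I_k := fun i j => i <= j.

Definition disjoint_union (S T : finType) (p : rel S) (r : rel T) :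
    rel (S + T)%type :=
  fun u v => match u, v with
             | inl a, inl b => p a b
             | inr a, inr b => r a b
             | _, _ => false
             end.

Definition poset_2p2 := disjoint_union (@chain_rel 2) (@chain_rel 2).
Definition poset_3p1 := disjoint_union (@chain_rel 3) (@chain_rel 1).

Definition is_semiorder (T : finType) (r : rel T) : bool :=
  [&& is_poset r, ~~ contains_induced poset_2p2 r &
      ~~ contains_induced poset_3p1 r].

Definition semiorders_le (l n : nat) : {set {ffun 'I_n -> {ffun 'I_n -> bool}}} :=
  [set r | is_semiorder (rel_of r) & poset_length (rel_of r) <= l].

(* Number of isomorphism classes of semiorders with n elements and length at
   most l. *)
Definition num_semiorders_le (l n : nat) : nat :=
  #|equivalence_partition (fun r s => poset_iso (rel_of r) (rel_of s))
                          (semiorders_le l n)|.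

(* Main.v *)
(* Sort a semiorder so that up-sets decrease: x < y then holds exactly when y
   has position at least n - up(x), so the decreasing list of the numbers up(x)
   is a complete isomorphism invariant, and a greedy chain computes the length.
   Reading n - up(x) as the number of nodes of a plane forest created, in
   breadth-first order, before the children of x are listed turns the invariant
   into a plane forest with n nodes, whose number of levels is the length plus
   one. If g_k is the generating function of forests with at most k levels, then
   g_(k+1) = 1 / (1 - X g_k), so that g_4 = (1 - 3X + X^2) / (1 - 4X + 3X^2). *)

Require Import Defs.
From mathcomp Require Import all_boot all_order all_algebra all_fingroup.
From mathcomp Require Import zify ring lra.

Set Implicit Arguments.
Unset Strict Implicit.
Unset Printing Implicit Defensive.

(** * Breadth-first enumeration of plane forests *)

(* Breadth-first growth of plane forests: p nodes of the current level and q of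
   the next one still have to receive their children, m nodes are yet to be
   created and k levels may still follow the current one. A step either creates
   a child of the current node or closes that node, recording m. The bound N is
   fuel, sufficient when N > p + 2 q + 3 m. *)
Fixpoint stairs (N k p q m : nat) : seq (seq nat) :=
  if N is N'.+1 then
    if p is p'.+1 then
      map (cons m) (stairs N' k p' q m) ++
      (if m is m'.+1 then stairs N' k p q.+1 m' else [::])
    else if q == 0 then (if m == 0 then [:: [::]] else [::])
    else if k is k'.+1 then stairs N' k' q 0 m else [::]
  else [::].

(* The number of nodes created once the first e nodes are closed; iterating it
   from the end of a level gives the ends of the next levels. *)
Definition bounce (s : seq nat) (m e : nat) : nat := size s - nth 0 (m :: s) e.

(** The second clause says that, after [j] closings, a created node is still open unless all
    [size s] nodes are closed; the third, that the levels are exhausted [k] levels after the current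
    one. *)
Definition staircase (k p m : nat) (s : seq nat) : Prop :=
  [/\ sorted geq (m :: s),
      forall j, nth 0 (m :: s) j <= size s - j.+1
    & iter k (bounce s m) p = size s].

(** Closing a node prepends [m] and so shifts every level end by one; the bound on the entries keeps
    the subtraction in [bounce] from truncating. *)
Lemma iter_bounce_cons k p m s :
  (forall j, nth 0 (m :: s) j <= size s - j.+1) ->
  iter k (bounce (m :: s) m) p.+1 = (iter k (bounce s m) p).+1.
Proof.
move=> les; elim: k => // k IHk; rewrite !iterS IHk.
move: (iter _ _ _) => e; rewrite /bounce [nth _ _ e.+1]/= [size (_ :: _)]/= subSn //.
exact: leq_trans (les e) (leq_subr _ _).
Qed.

(** The iterates stay positive, so the head is never read: creating a child changes [m] but no level
    end. *)
Lemma iter_bounce_head k p m m' s :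
  (forall j, nth 0 s j <= size s - j.+2) -> 0 < size s ->
  iter k (bounce s m) p.+1 = iter k (bounce s m') p.+1.
Proof.
move=> les s_gt0; suff [//]: iter k (bounce s m) p.+1 = iter k (bounce s m') p.+1
  /\ 0 < iter k (bounce s m) p.+1.
elim: k => //= k [<-]; case: (iter _ _ _) => // e _; rewrite /bounce /=.
by have := les e; split=> //; lia.
Qed.

(** The head of [s] reveals the step taken: it is [m] if the current node is closed at once, and
    smaller if a child comes first. The fuel bound drops by 1 in both cases, and by [q] when the
    level changes. *)
Lemma mem_stairs N k p q m (s : seq nat) : p + q.*2 + m * 3 < N ->
  (s \in stairs N k p q m) <-> size s = p + q + m /\ staircase k p m s.
Proof.
elim: N k p q m s => // N IHN k [|p] q m s ltN /=; last first.
  rewrite mem_cat; split.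
    case/orP=> [/mapP[s' /IHN-/(_ ltac:(lia))[sz [so les it]] ->]|].
      split; first by rewrite /= sz; lia.
      split; first by rewrite /= leqnn.
        by case=> [|j] /=; [rewrite sz; lia | apply: leq_trans (les j) _; lia].
      by rewrite iter_bounce_cons //= it.
    case: m ltN => // m ltN /IHN-/(_ ltac:(lia))[sz [so les it]].
    split; first by rewrite sz; lia.
    have les1 j : nth 0 s j <= size s - j.+2 by exact: (les j.+1).
    split; last by rewrite (iter_bounce_head _ _ _ m) //; rewrite sz; lia.
      by case: s so {sz les les1 it} => //= x s /andP[xm ->]; rewrite andbT /=; move: xm => /=; lia.
    by case=> [|j]; [rewrite sz /=; lia|exact: les1].
  case: s => [|x s] [] //= [sz] [/= /andP[xm so] les it].
  apply/orP; case: (eqVneq x m) => [ex|xNm]; [left; subst x|right].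
    apply: map_f; apply/IHN; first by lia.
    split=> //.
    split=> // [j|]; first exact: (les j.+1).
    apply: succn_inj; rewrite -it -iter_bounce_cons // => j.
    exact: (les j.+1).
  case: m ltN sz les it xNm xm => [|m] ltN sz les it xNm xm; first by move: xm => /=; lia.
  apply/IHN; first by lia.
  split; first by rewrite /= sz; lia.
  split; first by rewrite /= so andbT; move: xm => /=; lia.
    by case=> [|j]; [move=> /=; lia|exact: (les j.+1)].
  by rewrite (iter_bounce_head _ _ _ m.+1) // => j; exact: (les j.+1).
have [->|q0] := eqVneq q 0.
  have [->|m0] := eqVneq m 0.
    rewrite inE; split=> [/eqP->|[/size0nil->//]].
    split=> //; split=> //; first by case=> [|[]].
    by elim: k => //= k ->.
  rewrite in_nil; split=> // -[sz [_ /(_ 0) /=]]; rewrite sz; lia.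
case: k => [|k].
  by rewrite in_nil; split=> // -[sz [_ _ /=]]; rewrite sz; lia.
rewrite IHN; last by lia.
(* When a level is exhausted, one bounce from 0 lands on [q], the end of the next level. *)
have b0 : size s = 0 + q + m -> bounce s m 0 = q by rewrite /bounce /= => ->; lia.
rewrite /staircase iterSr; split=> -[sz].
  by rewrite b0; [split=> //; lia|lia].
by rewrite b0; [split=> //; lia|lia].
Qed.

Lemma stairs_uniq N k p q m : p + q.*2 + m * 3 < N -> uniq (stairs N k p q m).
Proof.
elim: N k p q m => // N IHN k [|p] q m ltN /=.
  case: eqVneq => [_|q0]; first by case: ifP.
  by case: k => // k; apply: IHN; lia.
rewrite cat_uniq map_inj_uniq => [|x y []//].
rewrite IHN /=; last by lia.
case: m ltN => // m ltN; rewrite IHN ?andbT; last by lia.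
(* Lists of the child-creating branch have a smaller head than those of the closing branch. *)
apply/hasPn => s /mem_stairs-/(_ ltac:(lia))[_ [so _ _]].
apply/mapP => -[s' _ es]; move: so; rewrite es /= => /andP[]; rewrite ltnn //.
Qed.

(** * Generating functions *)

Section GeneratingFunction.
Import GRing.Theory.
Local Open Scope ring_scope.
Variable R : comNzRingType.

(* Modulo X^N, [forest_gf N k.+1] is g_k, and [forest_gf N 0 = 0]. *)
Fixpoint forest_gf (N k : nat) : {poly R} :=
  if k is k'.+1 then \sum_(i < N) ('X * forest_gf N k') ^+ i else 0.

(** The geometric sum telescopes; the error stays an explicit multiple of X^N, invisible to
    coefficients below [N]. *)
Lemma forest_gfS N k :
  forest_gf N k.+1 * (1 - 'X * forest_gf N k) = 1 - 'X^N * forest_gf N k ^+ N.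
Proof.
by rewrite -exprMn mulrC; apply: oppr_inj; rewrite -mulNr !opprB subrX1.
Qed.

(** Each open node independently carries a forest, with at most [k] levels below the current level
    and one level fewer below the next; [forest_gf N 0 = 0] forbids a next level when [k = 0]. *)
Lemma size_stairs M N k p q m : (p + q.*2 + m * 3 < M)%N -> (m < N)%N ->
  (size (stairs M k p q m))%:R = (forest_gf N k.+1 ^+ p * forest_gf N k ^+ q)`_m.
Proof.
elim: M k p q m => // M IHM k [|p] q m ltM ltN.
  rewrite [stairs _ _ _ _ _]/= expr0 mul1r; case: (eqVneq q 0%N) => [->|q0].
    by rewrite expr0 coef1; case: eqP.
  case: k => [|k]; first by rewrite /= expr0n (negPf q0) coef0.
  rewrite (IHM k q 0%N m) //; last by lia.
  by rewrite expr0 mulr1.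
(* This is g = 1 + X g h - X^N h^N times g^p h^q; its first two terms are the closing and the
   child-creating branch. *)
have -> : forest_gf N k.+1 ^+ p.+1 * forest_gf N k ^+ q =
    forest_gf N k.+1 ^+ p * forest_gf N k ^+ q
    + 'X * (forest_gf N k.+1 ^+ p.+1 * forest_gf N k ^+ q.+1)
    - 'X^N * (forest_gf N k ^+ N * forest_gf N k.+1 ^+ p * forest_gf N k ^+ q).
  have := forest_gfS N k; move: (forest_gf N k.+1) (forest_gf N k) => g h e.
  transitivity ((g * (1 - 'X * h)) * (g ^+ p * h ^+ q)
                + 'X * (g ^+ p.+1 * h ^+ q.+1)).
    by rewrite !exprS; ring.
  by rewrite e; ring.
rewrite coefB coefD coefXM coefXnM ltN subr0 -(IHM k p q m) //.
rewrite /= size_cat size_map natrD; congr (_ + _).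
case: m ltM ltN => [|m] ltM ltN //; rewrite -(IHM k p.+1 q.+1 m) //; first by lia.
exact: ltnW.
Qed.

(** One step of the continued fraction: h = b / a turns 1 / (1 - X h) into a / (a - X b). *)
Lemma forest_gf_step N k (a b E : {poly R}) :
  forest_gf N k * a = b + 'X^N * E ->
  exists E', forest_gf N k.+1 * (a - 'X * b) = a + 'X^N * E'.
Proof.
have := forest_gfS N k; move: (forest_gf N k.+1) (forest_gf N k) => g h eg eh.
exists ('X * E * g - a * h ^+ N).
transitivity (g * (1 - 'X * h) * a + 'X * g * (h * a - b)); first by ring.
by rewrite eg eh; ring.
Qed.

(** Index 5 stands for g_4. From 0/1 the fractions are 1/1, 1/(1 - X), (1 - X)/(1 - 2X), (1 - 2X)/(1
    - 3X + X^2), and then this one. *)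
Lemma forest_gf5 N : exists E,
  forest_gf N 5 * (1 - 4%:R *: 'X + 3%:R *: 'X^2) =
  1 - 3%:R *: 'X + 'X^2 + 'X^N * E.
Proof.
have g0 : forest_gf N 0 * 1 = 0 + 'X^N * 0 by rewrite /= mul0r mulr0 addr0.
have [E1 g1] := forest_gf_step g0.
have [E2 g2] := forest_gf_step g1.
have [E3 g3] := forest_gf_step g2.
have [E4 g4] := forest_gf_step g3.
have [E5 g5] := forest_gf_step g4.
exists E5; move: g5; rewrite -!mul_polyC !polyCMn => g5.
transitivity (forest_gf N 5 *
  (1 - 'X * 0 - 'X * 1 - 'X * (1 - 'X * 0) - 'X * (1 - 'X * 0 - 'X * 1)
    - 'X * (1 - 'X * 0 - 'X * 1 - 'X * (1 - 'X * 0)))); first by ring.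
by rewrite g5; ring.
Qed.

End GeneratingFunction.

Section Coefficients.
Import GRing.Theory Num.Theory.
Local Open Scope ring_scope.

(** The denominator is (1 - X)(1 - 3X), whence the powers of 1 and 3. *)
Lemma coef_forest_gf5 N n : (n.+1 < N)%N ->
  (forest_gf rat N 5)`_n.+1 = (3%:R ^+ n + 1) / 2%:R.
Proof.
have [E gE] := forest_gf5 rat N; move: (forest_gf rat N 5) gE => g gE.
have rec m : (m < N)%N ->
    g`_m - 4%:R * (if m is m'.+1 then g`_m' else 0)
     + 3%:R * (if m is m'.+2 then g`_m' else 0)
    = (m == 0%N)%:R - 3%:R * (m == 1%N)%:R + (m == 2)%:R.
  move=> ltmN; have /polyP/(_ m) := gE.
  rewrite mulrDr mulrBr mulr1 -!scalerAr !coefD !coefN !coefZ coefMX coefMXn coef1.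
  rewrite coefX coefXn coefXnM ltmN addr0.
  by case: m {ltmN} => [|[|m]] //=; rewrite subn2.
(* The recurrence has order two, so two consecutive coefficients are carried, starting at index 1:
   the constant coefficient 1 does not fit the formula. *)
suff: (n.+1 < N)%N -> g`_n.+1 = (3%:R ^+ n + 1) / 2%:R /\
   ((n.+2 < N)%N -> g`_n.+2 = (3%:R ^+ n.+1 + 1) / 2%:R).
  by move=> H ltn; case: (H ltn).
elim: n => [lt1|n IHn ltn].
  have := rec 0%N (ltnW lt1); have := rec 1%N lt1.
  rewrite /= => e1 e0.
  have g0 : g`_0 = 1 by move: e0; lra.
  have g1 : g`_1 = 1 by move: e1; rewrite g0; lra.
  split; first by rewrite g1; lra.
  by move=> lt2; have := rec 2%N lt2; rewrite /= g0 g1; lra.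
have [IH1 IH2] := IHn (ltnW ltn); split; first exact: IH2.
move=> lt3; have := rec n.+3 lt3; rewrite /= IH1 (IH2 ltn) !exprS; lra.
Qed.

End Coefficients.

(** * Sorted semiorders *)

Section Posets.
Variable T : finType.
Implicit Types (r : rel T) (x y z : T).

Definition strict r x y := r x y && (x != y).

Lemma contains_induced_embedding (S : finType) (p : rel S) r (f : S -> T) :
  reflexive r -> antisymmetric p -> (forall a b, r (f a) (f b) = p a b) ->
  contains_induced p r.
Proof.
move=> rr pa rf; apply/existsP; exists (finfun f); apply/andP; split.
  apply/injectiveP => a b; rewrite !ffunE => fab.
  by apply: pa; rewrite -!rf fab rr.
by apply/forallP => a; apply/forallP => b; rewrite !ffunE rf.
Qed.

Lemma chain_rel_anti k : antisymmetric (@chain_rel k).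
Proof. by move=> i j /anti_leq/val_inj. Qed.

Lemma disjoint_union_anti (S1 S2 : finType) (p1 : rel S1) (p2 : rel S2) :
  antisymmetric p1 -> antisymmetric p2 -> antisymmetric (disjoint_union p1 p2).
Proof. by move=> a1 a2 [a|a] [b|b] //= => [/a1|/a2] ->. Qed.

Section Poset.
Variable r : rel T.
Hypothesis r_poset : is_poset r.

Lemma strict_irr x : strict r x x = false.
Proof. by rewrite /strict eqxx andbF. Qed.

Lemma strictW x y : strict r x y -> r x y.
Proof. by case/andP. Qed.

Lemma poset_leE x y : r x y = (x == y) || strict r x y.
Proof.
rewrite /strict; case: eqVneq => [->|_]; last by rewrite andbT.
by case/is_posetP: r_poset => -> _ _.
Qed.

Lemma le_strict_trans y x z : r x y -> strict r y z -> strict r x z.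
Proof.
have /is_posetP[rr ra rt] := r_poset.
move=> xy /andP[yz yz']; rewrite /strict (rt _ _ _ xy yz); apply: contraNneq yz' => exz.
by apply/eqP/ra; rewrite yz -exz xy.
Qed.

Lemma strict_le_trans y x z : strict r x y -> r y z -> strict r x z.
Proof.
have /is_posetP[rr ra rt] := r_poset.
move=> /andP[xy xy'] yz; rewrite /strict (rt _ _ _ xy yz); apply: contraNneq xy' => exz.
by apply/eqP/ra; rewrite xy exz yz.
Qed.

Lemma strict_trans : transitive (strict r).
Proof. by move=> y x z /strictW; apply: le_strict_trans. Qed.

Lemma strict_nle x y : strict r x y -> r y x = false.
Proof.
move=> xy; apply/negP => yx.
by have := strict_le_trans xy yx; rewrite strict_irr.
Qed.

(** If both conclusions fail, so does every comparison between the chains a < b and c < d, which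
    then form an induced 2+2. *)
Lemma free_2p2P :
  ~~ contains_induced poset_2p2 r <->
  (forall a b c d, strict r a b -> strict r c d -> strict r a d || strict r c b).
Proof.
have /is_posetP[rr ra rt] := r_poset.
split=> [free a b c d ab cd|free].
  apply: contraNT free; rewrite negb_or => /andP[ad cb].
  pose f (u : 'I_2 + 'I_2) := match u with
    | inl i => if i == 0 :> nat then a else b
    | inr i => if i == 0 :> nat then c else d end.
  have ac : r a c = false by apply: contraNF ad => /le_strict_trans; apply.
  have ca : r c a = false by apply: contraNF cb => /le_strict_trans; apply.
  have bd : r b d = false by apply: contraNF ad; apply: strict_le_trans.
  have db : r d b = false by apply: contraNF cb; apply: strict_le_trans.
  have ad' : r a d = false.
    apply: contraNF ad; rewrite poset_leE => /orP[/eqP ead|//].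
    by move: ac; rewrite -[r a c]negbK ead; move: ab bd; rewrite ead => /strictW; rewrite db.
  have cb' : r c b = false.
    apply: contraNF cb; rewrite poset_leE => /orP[/eqP ecb|//].
    by move: ab ad'; rewrite -ecb => /strictW/rt/(_ (strictW cd)) ->.
  have da : r d a = false by apply: contraFF cb' => /(rt _ _ _ (strictW cd))/rt/(_ (strictW ab)).
  have bc : r b c = false by apply: contraFF ad' => /(rt _ _ _ (strictW ab))/rt/(_ (strictW cd)).
  apply: (@contains_induced_embedding _ _ _ f rr).
    by apply: disjoint_union_anti; apply: chain_rel_anti.
  move=> [[[|[|i]] //= ?]|[[|[|i]] //= ?]] [[[|[|j]] //= ?]|[[|[|j]] //= ?]];
    by rewrite ?rr ?(strictW ab) ?(strictW cd) ?(strict_nle ab) ?(strict_nle cd).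
apply/negP => /existsP[f /andP[/injectiveP f_inj /forallP fr]].
have rf u v : r (f u) (f v) = poset_2p2 u v by apply/eqP/(forallP (fr u)).
have sf u v : strict r (f u) (f v) = poset_2p2 u v && (u != v).
  by rewrite /strict rf (inj_eq f_inj).
have := free (f (inl ord0)) (f (inl ord_max)) (f (inr ord0)) (f (inr ord_max)).
by rewrite !sf /= => /(_ isT isT).
Qed.

(** Any comparison of [d] with the chain a < b < c would give a < d or d < c. *)
Lemma free_3p1P :
  ~~ contains_induced poset_3p1 r <->
  (forall a b c d, strict r a b -> strict r b c -> strict r a d || strict r d c).
Proof.
have /is_posetP[rr ra rt] := r_poset.
split=> [free a b c d ab bc|free].
  apply: contraNT free; rewrite negb_or => /andP[ad dc].
  pose f (u : 'I_3 + 'I_1) := match u with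
    | inl i => if i == 0 :> nat then a else if i == 1 :> nat then b else c
    | inr i => d end.
  have ac := strict_trans ab bc.
  have da : r d a = false by apply: contraNF dc => /le_strict_trans; apply.
  have db : r d b = false by apply: contraNF dc => /le_strict_trans; apply.
  have bd : r b d = false by apply: contraNF ad; apply: strict_le_trans.
  have cd : r c d = false by apply: contraNF ad; apply: strict_le_trans.
  have ad' : r a d = false.
    apply: contraNF ad; rewrite poset_leE => /orP[/eqP ead|//].
    by move: da; rewrite ead rr.
  have dc' : r d c = false.
    apply: contraNF dc; rewrite poset_leE => /orP[/eqP ead|//].
    by move: cd; rewrite ead rr.
  apply: (@contains_induced_embedding _ _ _ f rr).
    by apply: disjoint_union_anti; apply: chain_rel_anti.
  move=> [[[|[|[|i]]] //= ?]|[[|i] //= ?]] [[[|[|[|j]]] //= ?]|[[|j] //= ?]];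
    by rewrite ?rr ?(strictW ab) ?(strictW bc) ?(strictW ac)
       ?(strict_nle ab) ?(strict_nle ac) ?(strict_nle bc).
apply/negP => /existsP[f /andP[/injectiveP f_inj /forallP fr]].
have rf u v : r (f u) (f v) = poset_3p1 u v by apply/eqP/(forallP (fr u)).
have sf u v : strict r (f u) (f v) = poset_3p1 u v && (u != v).
  by rewrite /strict rf (inj_eq f_inj).
have := free (f (inl ord0)) (f (inl (@Ordinal 3 1 isT))) (f (inl ord_max)) (f (inr ord0)).
by rewrite !sf /= => /(_ isT isT).
Qed.

End Poset.

Definition up_count r x := #|[pred y | strict r x y]|.
Definition down_count r x := #|[pred y | strict r y x]|.

(** In a semiorder, growing down-sets and shrinking up-sets never conflict, so this sum sorts by
    both at once. *)
Definition sort_key r x := down_count r x + (#|T| - up_count r x).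
Definition semiorder_sort r := sort (relpre (sort_key r) leq) (enum T).

(* The final 0 and, in [num_semiorders_leE], the start p = 1 come from a virtual
   root that turns the forest into a tree. *)
Definition up_code r := rcons (sort geq [seq up_count r x | x <- enum T]) 0.

End Posets.

Lemma size_semiorder_sort (T : finType) (r : rel T) : size (semiorder_sort r) = #|T|.
Proof. by rewrite size_sort -cardE. Qed.

Lemma semiorder_sort_uniq (T : finType) (r : rel T) : uniq (semiorder_sort r).
Proof. by rewrite sort_uniq enum_uniq. Qed.

Lemma mem_semiorder_sort (T : finType) (r : rel T) x : x \in semiorder_sort r.
Proof. by rewrite mem_sort mem_enum. Qed.

(** A predicate inherited by later entries holds exactly on a suffix, of length [count P s]. *)
Lemma sorted_upclosed_nth (S : Type) (P : pred S) (x0 : S) s j :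
  sorted (fun x y => P x ==> P y) s -> j < size s ->
  P (nth x0 s j) = (size s - count P s <= j).
Proof.
elim: s j => // x s IHs j /=; case Px: (P x) => so; last first.
  rewrite add0n subSn ?count_size //; case: j => [|j] //=.
  by rewrite !ltnS; apply: IHs; exact: path_sorted so.
have all_s : all P (x :: s).
  elim: s x Px so {IHs} => [|y s IHs] x Px /=; first by rewrite Px.
  by case/andP; rewrite Px /= => Py /(IHs y Py).
move=> ltj; rewrite (all_nthP x0 all_s j ltj).
move: all_s; rewrite all_count => /eqP/= cs.
by rewrite -cs Px subnn.
Qed.

Lemma count_enum (T : finType) (P : pred T) : count P (enum T) = #|P|.
Proof. by rewrite cardE size_filter enumT. Qed.

Lemma geq_trans : transitive geq.
Proof. by move=> y x z /= xy yz; exact: leq_trans yz xy. Qed.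

Lemma geq_total : total geq.
Proof. by move=> x y; exact: leq_total. Qed.

Lemma geq_anti : antisymmetric geq.
Proof. by move=> x y; rewrite andbC => /anti_leq. Qed.

Section Semiorder.
Variables (T : finType) (r : rel T).
Hypothesis r_semi : is_semiorder r.

Let r_poset : is_poset r. Proof. by case/and3P: r_semi. Qed.

Let free_2p2 a b c d : strict r a b -> strict r c d -> strict r a d || strict r c b.
Proof. by case/and3P: r_semi => _ /(free_2p2P r_poset) free _; apply: free. Qed.

Let free_3p1 a b c d : strict r a b -> strict r b c -> strict r a d || strict r d c.
Proof. by case/and3P: r_semi => _ _ /(free_3p1P r_poset) free; apply: free. Qed.

(** Without 2+2 the up-sets form a chain under inclusion, so comparing sizes compares the sets. *)
Lemma up_nested x y z : up_count r x <= up_count r y -> strict r x z -> strict r y z.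
Proof.
move=> le_up xz; apply: contraTT le_up => /negPf yz; rewrite -ltnNge.
apply: proper_card; apply/properP; split; last by exists z; rewrite !inE ?yz.
by apply/subsetP => w; rewrite !inE => /free_2p2/(_ xz); rewrite yz.
Qed.

Lemma down_nested x y z : down_count r x <= down_count r y -> strict r z x -> strict r z y.
Proof.
move=> le_dn zx; apply: contraTT le_dn => /negPf zy; rewrite -ltnNge.
apply: proper_card; apply/properP; split; last by exists z; rewrite !inE ?zy.
by apply/subsetP => w; rewrite !inE => /free_2p2/(_ zx); rewrite zy orbF.
Qed.

(** If some w is below x but not below y, then for each z above x the chain w < x < z forces y < z,
    by the absence of 3+1. *)
Lemma up_down_compat x y : up_count r y < up_count r x -> down_count r x <= down_count r y.
Proof.
rewrite ltnNge; apply: contraNT; rewrite -ltnNge => lt_dn.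
apply: subset_leq_card; apply/subsetP => z; rewrite !inE => xz.
have /subsetPn[w] : ~~ ([pred w | strict r w x] \subset [pred w | strict r w y]).
  by apply: contraL lt_dn => /subset_leq_card; rewrite -leqNgt.
by rewrite !inE => wx /negPf wy; have := @free_3p1 _ _ _ y wx xz; rewrite wy.
Qed.

Lemma sort_key_le x y : sort_key r x <= sort_key r y ->
  up_count r y <= up_count r x /\ down_count r x <= down_count r y.
Proof.
have upx : up_count r x <= #|T| by exact: max_card.
have upy : up_count r y <= #|T| by exact: max_card.
rewrite /sort_key => le_key; split; rewrite leqNgt; apply/negP => lt.
  by have := up_down_compat lt; lia.
have := @up_down_compat x y; lia.
Qed.

(** Down-sets grow along the sorted list, so the up-set of [x] is a suffix of it. *)
Lemma strict_sort_nth x0 x j : j < #|T| ->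
  strict r x (nth x0 (semiorder_sort r) j) = (#|T| - up_count r x <= j).
Proof.
move=> ltj; have -> : up_count r x = count (strict r x) (semiorder_sort r).
  by rewrite count_sort count_enum.
rewrite -(size_semiorder_sort r) -(@sorted_upclosed_nth _ _ x0) ?size_semiorder_sort //.
apply: sub_sorted (sort_sorted _ (enum T)) => [y z /sort_key_le[_ le_dn]|y z].
  by apply/implyP; apply: down_nested.
exact: leq_total.
Qed.

Lemma up_codeE : up_code r = rcons (map (up_count r) (semiorder_sort r)) 0.
Proof.
congr rcons; apply: (sorted_eq geq_trans geq_anti).
- exact: sort_sorted geq_total _.
- rewrite sorted_map; apply: sub_sorted (sort_sorted _ (enum T)).
    by move=> x y /sort_key_le[].
  by move=> x y; exact: leq_total.
- by rewrite perm_sort perm_sym perm_map // perm_sort.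
Qed.

Lemma nth_up_code x0 i : i < #|T| ->
  nth 0 (up_code r) i = up_count r (nth x0 (semiorder_sort r) i).
Proof.
move=> lti; rewrite up_codeE nth_rcons size_map size_semiorder_sort lti.
by rewrite (nth_map x0) ?size_semiorder_sort.
Qed.

Lemma index_semiorder_sort x : index x (semiorder_sort r) < #|T|.
Proof. by rewrite -(size_semiorder_sort r) index_mem mem_semiorder_sort. Qed.

Lemma strict_index x y : strict r x y =
  (#|T| - nth 0 (up_code r) (index x (semiorder_sort r)) <= index y (semiorder_sort r)).
Proof.
rewrite (nth_up_code x) ?index_semiorder_sort // nth_index ?mem_semiorder_sort //.
by rewrite -(strict_sort_nth x) ?index_semiorder_sort // nth_index ?mem_semiorder_sort.
Qed.

Lemma size_up_code : size (up_code r) = #|T|.+1.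
Proof. by rewrite size_rcons size_sort size_map -cardE. Qed.

Lemma up_code_staircase l : poset_length r <= l ->
  staircase l.+1 1 #|T| (up_code r).
Proof.
move=> len_r.
have les j : nth 0 (#|T| :: up_code r) j <= size (up_code r) - j.+1.
  rewrite size_up_code; case: j => [|j] /=; first by rewrite subSS subn0.
  have [ltj|] := ltnP j #|T|; last first.
    rewrite leq_eqVlt => /orP[/eqP<-|ltj].
      by rewrite up_codeE nth_rcons size_map size_semiorder_sort ltnn eqxx.
    by rewrite nth_default // size_up_code.
  case: (pickP T) => [x0 _|T0]; last by rewrite (eq_card0 T0) in ltj.
  rewrite (nth_up_code x0) //.
  have := strict_sort_nth x0 (nth x0 (semiorder_sort r) j) ltj.
  rewrite strict_irr => /esym/negbT; rewrite -ltnNge; set u := up_count _ _.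
  by move: #|T| => n; lia.
have so : sorted geq (#|T| :: up_code r).
  rewrite up_codeE /= rcons_path /= andbT path_sortedE; last exact: geq_trans.
  apply/andP; split; first by apply/allP => _ /mapP[x _ ->]; exact: max_card.
  have := sort_sorted geq_total [seq up_count r x | x <- enum T].
  have : up_code r = rcons (sort geq [seq up_count r x | x <- enum T]) 0 by [].
  by rewrite up_codeE => /rcons_inj[->].
split=> //.
(* [(c t).-1] is the position of the t-th element of the greedy chain, which always moves to the
   first element above; the virtual root causes the shift by one. *)
set b := bounce _ _; pose c t := iter t b 1.
have le_b e : e <= #|T|.+1 -> e <= b e <= #|T|.+1.
  move=> le_e; rewrite /b /bounce; have := les e; rewrite size_up_code.
  move: (nth _ _ _) => u; lia.
have le_c t : c t <= #|T|.+1 by elim: t => //= t /le_b/andP[].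
have c_mono : {homo c : t u / t <= u}.
  apply: homo_leq => [//|? ? ?|t]; first exact: leq_trans.
  by case/andP: (le_b _ (le_c t)).
(* If the bounces stopped short of the end, the greedy chain would have [l.+2] elements, hence
   length above [l]. *)
apply/eqP; rewrite size_up_code -/(c l.+1) eqn_leq le_c leqNgt /=; apply/negP => lt_c.
have c_gt0 t : 0 < c t by exact: (c_mono 0 t).
have lt_cT t : t <= l.+1 -> (c t).-1 < #|T|.
  by move=> /c_mono le_cl; rewrite prednK //; rewrite -ltnS (leq_ltn_trans le_cl).
case: (pickP T) => [x0 _|T0]; last by have := lt_cT 0 isT; rewrite (eq_card0 T0).
pose z t := nth x0 (semiorder_sort r) (c t).-1.
have z_lt t u : t < u -> u <= l.+1 -> strict r (z t) (z u).
  move=> tu ul; rewrite strict_sort_nth ?lt_cT //.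
  rewrite -nth_up_code ?lt_cT ?(leq_trans (ltnW tu)) //.
  have := c_mono _ _ tu; rewrite {1}/c iterS -/(c t) /b /bounce size_up_code.
  by case: (c t) (c_gt0 t) => //= e _; lia.
have z_inj : injective (fun t : 'I_l.+2 => z t).
  move=> t u ztu; apply/val_inj/eqP; rewrite eqn_leq; apply/andP; split;
    rewrite leqNgt; apply/negP => /z_lt; rewrite -ltnS ltn_ord ztu strict_irr;
    by move/(_ isT).
have : #|[set z t | t : 'I_l.+2]|.-1 <= poset_length r.
  apply: (@leq_bigmax_cond _ (is_chain r) (fun A : {set T} => #|A|.-1)).
  apply/forallP => x; apply/implyP => /imsetP[t _ ->].
  apply/forallP => y; apply/implyP => /imsetP[u _ ->].
  rewrite !(poset_leE r_poset).
  have [lt_tu|lt_ut|->] := ltngtP (val t) (val u); last by rewrite eqxx.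
    by rewrite (z_lt _ _ lt_tu (ltn_ord u)) orbT.
  by rewrite (z_lt _ _ lt_ut (ltn_ord t)) !orbT.
by rewrite card_imset // card_ord /=; move/leq_trans/(_ len_r); rewrite ltnn.
Qed.

End Semiorder.

Lemma up_code_iso (T : finType) (r r' : rel T) : is_semiorder r -> is_semiorder r' ->
  poset_iso r r' = (up_code r == up_code r').
Proof.
move=> semi_r semi_r'; apply/idP/eqP => [/poset_isoP[p rp]|eq_code].
  have up_p x : up_count r x = up_count r' (p x).
    rewrite /up_count -!sum1_card [RHS](reindex_inj (@perm_inj _ p)) /=.
    by apply: eq_bigl => y; rewrite !inE /strict rp (inj_eq perm_inj).
  congr rcons; apply/(perm_sortP geq_total geq_trans geq_anti).
  rewrite (eq_map up_p) (map_comp (up_count r') p) perm_map //.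
  apply: uniq_perm; rewrite ?(map_inj_uniq perm_inj) ?enum_uniq // => x.
  by rewrite mem_enum -[x](permKV p) map_f ?mem_enum.
(* Match elements of equal sorted position; by [strict_index], positions and code determine the
   order. *)
pose h x := nth x (semiorder_sort r') (index x (semiorder_sort r)).
have lt_ix x : index x (semiorder_sort r) < size (semiorder_sort r').
  by rewrite size_semiorder_sort; exact: index_semiorder_sort.
have index_h x : index (h x) (semiorder_sort r') = index x (semiorder_sort r).
  by rewrite index_uniq ?semiorder_sort_uniq.
have h_inj : injective h.
  move=> x y /(congr1 (index^~ (semiorder_sort r'))); rewrite !index_h => eq_ix.
  by rewrite -(nth_index x (mem_semiorder_sort r x)) eq_ix nth_index ?mem_semiorder_sort.
apply/poset_isoP; exists (perm h_inj) => x y; rewrite !permE.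
have [[pr _ _] [pr' _ _]] := (and3P semi_r, and3P semi_r').
rewrite (poset_leE pr) (poset_leE pr') (inj_eq h_inj); congr orb.
by rewrite !strict_index // !index_h eq_code.
Qed.

(** * The semiorder of a staircase *)

Lemma card_ord_ge n a : a <= n -> #|[pred j : 'I_n | n - a <= j]| = a.
Proof.
move=> le_an; rewrite -count_enum (eq_count (a2 := preim val (leq (n - a)))) //.
rewrite -count_map val_enum_ord -{2}(subnK le_an) iotaD count_cat add0n.
rewrite (eq_in_count (a2 := pred0)) => [|j]; last first.
  by rewrite mem_iota add0n => /andP[_ lt_j]; rewrite leqNgt lt_j.
rewrite count_pred0 (eq_in_count (a2 := predT)) => [|j].
  by rewrite count_predT size_iota.
by rewrite mem_iota => /andP[].
Qed.

Section PosetOfCode.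
Variables (n l : nat) (s : seq nat) (r : rel 'I_n).
Hypothesis size_s : size s = n.+1.
Hypothesis stair_s : staircase l.+1 1 n s.
Hypothesis rE : forall i j, r i j = (i == j) || (n - nth 0 s i <= j).

(** The first position above [i], with [n] meaning that there is none. *)
Let f i := n - nth 0 s i.

Let nth_s i : nth 0 s i <= n - i.+1.
Proof. by case: stair_s => _ /(_ i.+1) /=; rewrite size_s subSS. Qed.

Let f_mono i j : i <= j -> f i <= f j.
Proof.
move=> le_ij; rewrite leq_sub2l //.
have [lt_j|le_j] := ltnP j (size s); last by rewrite (nth_default _ le_j).
case: stair_s => /path_sorted so _ _.
by apply: (sorted_leq_nth geq_trans leqnn 0 so); rewrite ?inE ?(leq_ltn_trans le_ij).
Qed.

Let f_gt i : i < n -> i < f i.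
Proof. by have := nth_s i; rewrite /f; lia. Qed.

Let strictE i j : strict r i j = (f i <= j).
Proof.
rewrite /strict rE -/(f i); case: eqVneq => [->|_]; last by rewrite andbT.
by rewrite andbF leqNgt f_gt.
Qed.

Let f_bounce t : iter t (bounce s n) 1 = (iter t f 0).+1.
Proof.
elim: t => //= t ->; rewrite /bounce size_s /= /f subSn //.
by rewrite (leq_trans (nth_s _)) ?leq_subr.
Qed.

Let iter_f : iter l.+1 f 0 = n.
Proof. by case: stair_s => _ _; rewrite f_bounce size_s => -[]. Qed.

Lemma poset_of_code : is_poset r.
Proof.
have lt_rel (i j : 'I_n) : n - nth 0 s i <= j -> i < j.
  by apply: leq_trans; exact: f_gt.
apply/is_posetP; split=> [i|i j|j i k]; rewrite !rE ?eqxx //.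
  have [//|_] := eqVneq i j => /= /andP[/lt_rel ij /lt_rel ji].
  by have := ltn_trans ij ji; rewrite ltnn.
have [->//|_ /=] := eqVneq i j; have [<-|_ /= ij jk] := eqVneq j k.
  by move=> ->; rewrite orbT.
by rewrite (leq_trans ij (ltnW (lt_rel _ _ jk))) orbT.
Qed.

(** Monotonicity of [f] suffices: for 2+2 compare [a] with [c]; for 3+1, d < f a <= b gives f d <= f
    b <= c. *)
Lemma semiorder_of_code : is_semiorder r.
Proof.
apply/and3P; split; first exact: poset_of_code.
  apply/(free_2p2P poset_of_code) => a b c d; rewrite !strictE => ab cd.
  have [ac|ca] := leqP a c; first by rewrite (leq_trans (f_mono ac) cd).
  by rewrite (leq_trans (f_mono (ltnW ca)) ab) orbT.
apply/(free_3p1P poset_of_code) => a b c d; rewrite !strictE => ab bc.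
have [//|da] := leqP (f a) d.
by rewrite (leq_trans _ bc) // f_mono // (leq_trans _ ab) // ltnW.
Qed.

(* The number of bounce points weakly below x takes at most l + 1 values and is
   strictly increasing along the order. *)
Lemma length_of_code : poset_length r <= l.
Proof.
pose lev (x : 'I_n) := \sum_(t < l) (iter t.+1 f 0 <= x).
have lev_le x : lev x < l.+1.
  rewrite ltnS; apply: (@leq_trans (\sum_(t < l) 1)).
    by apply: leq_sum => t _; exact: leq_b1.
  by rewrite sum_nat_const card_ord muln1.
have lev_lt x y : strict r x y -> lev x < lev y.
  rewrite strictE /lev => xy; case: l iter_f => [|l'] itf.
    have := leq_trans (f_mono (leq0n x)) xy; rewrite -[f 0]/(iter 1 f 0) itf.
    by rewrite leqNgt ltn_ord.
  (* Each bounce point at or below [x] has its successor at or below [y]. The first one is at or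
     below [y] in any case, and the last is not at or below [x], since its successor is [n]. *)
  rewrite big_ord_recr big_ord_recl /=.
  have -> : f (iter l' f 0) <= x = false.
    apply/negP => /f_mono/leq_trans/(_ xy).
    by rewrite -!iterS itf leqNgt ltn_ord.
  rewrite addn0 (leq_trans (f_mono (leq0n x)) xy) add1n ltnS leq_sum // => t _.
  case ft: (_ <= x) => //=.
  by rewrite add0n (leq_trans (f_mono ft) xy).
apply/bigmax_leqP => A /forallP chA.
have lev_inj : {in A &, injective (fun x => Ordinal (lev_le x))}.
  move=> x y Ax Ay [eq_lev]; apply/eqP.
  have /forallP/(_ y)/implyP/(_ Ay) := implyP (chA x) Ax.
  rewrite !(poset_leE poset_of_code) eq_sym; case: eqVneq => //= _.
  by case/orP=> /lev_lt; rewrite eq_lev ltnn.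
rewrite -(card_in_imset lev_inj) -subn1 leq_subLR add1n.
by rewrite (leq_trans (max_card _)) ?card_ord.
Qed.

Lemma up_code_of_code : up_code r = s.
Proof.
have up_s i : up_count r i = nth 0 s i.
  rewrite -[RHS](@card_ord_ge n); last by rewrite (leq_trans (nth_s i)) ?leq_subr.
  by apply: eq_card => j; rewrite !inE strictE.
have s_last : nth 0 s n = 0 by have := nth_s n; rewrite subnS subnn; case: nth.
have s_rcons : s = rcons (take n s) 0.
  by rewrite -s_last -take_nth ?size_s // -size_s take_size.
rewrite s_rcons /up_code (eq_map up_s); congr rcons.
have -> : [seq nth 0 s (i : 'I_n) | i <- enum 'I_n] = take n s.
  rewrite (map_comp (nth 0 s) val) val_enum_ord map_nth_iota0 ?size_s //.
by case: stair_s => /path_sorted so _ _; apply: sorted_sort geq_trans _ _; exact: take_sorted.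
Qed.

End PosetOfCode.

(** * Counting isomorphism classes *)

(** The classes are the fibres of [h], which are nonempty and distinct over the entries of [L]. *)
Lemma card_equivalence_partition (X : finType) (Y : eqType) (D : {set X})
    (R : rel X) (h : X -> Y) (L : seq Y) :
  {in D &, forall x y, R x y = (h x == h y)} -> uniq L ->
  (forall x, x \in D -> h x \in L) ->
  (forall y, y \in L -> exists2 x, x \in D & h x = y) ->
  #|equivalence_partition R D| = size L.
Proof.
move=> Rh L_uniq hL L_h; pose F y := [set x in D | h x == y].
have F_inj : {in L &, injective F}.
  move=> _ y /L_h[x Dx <-] _ /setP/(_ x); rewrite !inE Dx eqxx /=.
  by move/esym/eqP.
rewrite -(size_map F) -(card_uniqP _) ?map_inj_in_uniq //.
apply: eq_card => B; apply/imsetP/mapP => [[x Dx ->]|[y /L_h[x Dx <-] ->]].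
  exists (h x); first exact: hL.
  by apply/setP => z; rewrite !inE; case Dz: (z \in D) => //=; rewrite Rh // eq_sym.
exists x => //.
by apply/setP => z; rewrite !inE; case Dz: (z \in D) => //=; rewrite Rh // eq_sym.
Qed.

(** A longest chain has at most [l.+1] elements, so [l.+1] levels may follow that of the virtual
    root. *)
Lemma num_semiorders_leE l n N : (n * 3).+1 < N ->
  num_semiorders_le l n = size (stairs N l.+1 1 0 n).
Proof.
move=> ltN; have ltN' : 1 + 0.*2 + n * 3 < N by [].
apply: (@card_equivalence_partition _ _ _ _ (fun r => up_code (rel_of r))).
- move=> r r'; rewrite !inE => /andP[semi_r _] /andP[semi_r' _].
  exact: up_code_iso.
- exact: stairs_uniq.
- move=> r; rewrite inE => /andP[semi_r len_r]; apply/(mem_stairs _ _ ltN').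
  have := up_code_staircase semi_r len_r; rewrite size_up_code card_ord.
  by rewrite addn0 add1n.
- move=> s /(mem_stairs _ _ ltN')[]; rewrite addn0 add1n => size_s stair_s.
  pose r := [ffun i : 'I_n => [ffun j : 'I_n => (i == j) || (n - nth 0 s i <= j)]].
  have rE i j : rel_of r i j = (i == j) || (n - nth 0 s i <= j).
    by rewrite /rel_of !ffunE.
  exists r; last exact: up_code_of_code size_s stair_s rE.
  rewrite inE (semiorder_of_code size_s stair_s rE).
  exact: length_of_code size_s stair_s rE.
Qed.

Import GRing.Theory Num.Theory.
Local Open Scope ring_scope.

Theorem theorem5p9 (n : nat) (hn : (1 <= n)%N) :
  (num_semiorders_le 3 n)%:R = (3%:R ^+ (n - 1)%N + 1) / 2%:R :> rat.
Proof.
case: n hn => // n _; rewrite subn1 (num_semiorders_leE _ (ltnSn _)).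
(* Truncating at [n.+2] keeps the coefficient of index [n.+1]; with p = 1 and q = 0 the product is
   g_4 alone. *)
rewrite (@size_stairs _ _ n.+2) // ?expr0 ?expr1 ?mulr1.
exact: coef_forest_gf5.
Qed.
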